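(* Let $F \subseteq E$ be a Galois extension and let $\mathfrak{g}$ be a finite-dimensional Lie algebra over $E$ which is defined over the subfield $F$. Let $\mathfrak{h}$ be another finite-dimensional Lie algebra over $E$ such that $\mathfrak{g}_F \cong \mathfrak{h}_F$ as Lie algebras over $F$. Then $\mathfrak{g} \cong \mathfrak{h}$ as Lie algebras over $E$ if at least one of the following holds: (1) the Lie algebra $\mathfrak{h}$ is defined over $F$; or (2) the Lie algebra $\mathfrak{g}$ is indecomposable.
   Context: A Galois extension $F \subseteq E$ means a field extension of finite degree with $|\mathrm{Aut}(E,F)| = [E:F]$, where $\mathrm{Aut}(E,F)$ is the group of field automorphisms of $E$ fixing $F$ pointwise. For a Lie algebra $\mathfrak{g}$ over $E$, the underlying Lie algebra $\mathfrak{g}_F$ is $\mathfrak{g}$ regarded as a Lie algebra over $F$ by restricting the scalar multiplication. A Lie algebra $\mathfrak{g}$ over $E$ is defined over $F$ if there is a Lie algebra $\mathfrak{m}$ over $F$ with $\mathfrak{g} \cong \mathfrak{m} \otimes_F E$ as Lie algebras over $E$. A Lie algebra is decomposable if it is the direct sum of two proper ideals, and indecomposable otherwise. *)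

(* Defs.v *)
From HB Require Import structures.
From mathcomp Require Import all_boot all_algebra all_field.

Set Implicit Arguments.
Unset Strict Implicit.
Unset Printing Implicit Defensive.

Import GRing.Theory.
Local Open Scope ring_scope.

HB.mixin Record Lmodule_isLieAlgebra (K : fieldType) L of GRing.Lmodule K L := {
  lie : L -> L -> L;
  lie_linearl : forall z a x y, lie (a *: x + y) z = a *: lie x z + lie y z;
  lie_linearr : forall z a x y, lie z (a *: x + y) = a *: lie z x + lie z y;
  liexx : forall x, lie x x = 0;
  lie_jacobi : forall x y z,
    lie x (lie y z) + lie y (lie z x) + lie z (lie x y) = 0
}.

#[short(type="lieAlgType")]
HB.structure Definition LieAlgebra (K : fieldType) :=
  {L of Lmodule_isLieAlgebra K L & GRing.Lmodule K L}.

#[short(type="finLieAlgType")]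
HB.structure Definition FinLieAlgebra (K : fieldType) :=
  {L of LieAlgebra K L & Vector K L}.

Notation "[< x , y >]" := (lie x y) (format "[< x ,  y >]") : ring_scope.

Definition lie_isomorphic (K : fieldType) (g h : lieAlgType K) : Prop :=
  exists f : {linear g -> h},
    bijective f /\ forall x y, f [< x, y >] = [< f x, f y >].

Definition lie_ideal (K : fieldType) (g : finLieAlgType K) (I : {vspace g}) :
    Prop :=
  forall x y : g, y \in I -> [< x, y >] \in I.

Definition decomposable (K : fieldType) (g : finLieAlgType K) : Prop :=
  exists I J : {vspace g},
    [/\ lie_ideal I /\ I != fullv, lie_ideal J /\ J != fullv,
        (I + J)%VS = fullv & directv (I + J)].

Definition indecomposable (K : fieldType) (g : finLieAlgType K) : Prop :=
  ~ decomposable g.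

(* |Aut(E, F)| = [E : F]; finiteness of the degree is part of [fieldExtType].
   [kAut 1 {:E}] holds of the field automorphisms of E fixing F pointwise. *)
Definition galois_extension (F : fieldType) (E : fieldExtType F) : Prop :=
  exists s : seq 'End(E),
    [/\ uniq s, forall f : 'End(E), (f \in s) = kAut 1 {:E} f
      & size s = \dim {:E}].
Arguments galois_extension F E : clear implicits.

Section LieTheory.

Variables (K : fieldType) (g : lieAlgType K).
Implicit Types x y z : g.

Lemma lieDl x y z : [< x + y, z >] = [< x, z >] + [< y, z >].
Proof. by rewrite -[x]scale1r lie_linearl !scale1r. Qed.

Lemma lieDr x y z : [< z, x + y >] = [< z, x >] + [< z, y >].
Proof. by rewrite -[x]scale1r lie_linearr !scale1r. Qed.

Lemma lie0l z : [< 0, z >] = 0.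
Proof. by apply: (addIr [< 0, z >]); rewrite -lieDl !add0r. Qed.

Lemma lie0r z : [< z, 0 >] = 0.
Proof. by apply: (addIr [< z, 0 >]); rewrite -lieDr !add0r. Qed.

Lemma lieZl a x z : [< a *: x, z >] = a *: [< x, z >].
Proof. by rewrite -[a *: x]addr0 lie_linearl lie0l addr0. Qed.

Lemma lieZr a x z : [< z, a *: x >] = a *: [< z, x >].
Proof. by rewrite -[a *: x]addr0 lie_linearr lie0r addr0. Qed.

Lemma lie_suml I (r : seq I) (P : pred I) (u : I -> g) z :
  [< \sum_(i <- r | P i) u i, z >] = \sum_(i <- r | P i) [< u i, z >].
Proof.
by apply: (big_morph (fun x => [< x, z >]) (fun x y => lieDl x y z) (lie0l z)).
Qed.

Lemma lie_sumr I (r : seq I) (P : pred I) (u : I -> g) z :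
  [< z, \sum_(i <- r | P i) u i >] = \sum_(i <- r | P i) [< z, u i >].
Proof.
by apply: (big_morph (fun x => [< z, x >]) (fun x y => lieDr x y z) (lie0r z)).
Qed.

Lemma lieNC x y : [< x, y >] = - [< y, x >].
Proof.
apply/eqP; rewrite -addr_eq0 -(liexx (x + y)) lieDl !lieDr !liexx.
by rewrite add0r addr0.
Qed.

End LieTheory.

(* Restriction of scalars: c : F acts on V as c%:A = c *: 1 : E. *)
Definition restrict_scalars (F : fieldType) (E : fieldExtType F) (V : Type) :
  Type := V.
Arguments restrict_scalars [F] E V.

Section RestrictScalars.

Variables (F : fieldType) (E : fieldExtType F).

Section Lmodule.

Variable V : lmodType E.
Local Notation V_F := (restrict_scalars E V).

HB.instance Definition _ := GRing.Zmodule.on V_F.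

Definition restrict_scale (c : F) (v : V_F) : V_F := (c%:A : E) *: (v : V).

Fact restrict_scaleA a b v :
  restrict_scale a (restrict_scale b v) = restrict_scale (a * b) v.
Proof. by rewrite /restrict_scale scalerA mulr_algl scalerA. Qed.

Fact restrict_scale1 : left_id 1 restrict_scale.
Proof. by move=> v; rewrite /restrict_scale !scale1r. Qed.

Fact restrict_scaleDr : right_distributive restrict_scale +%R.
Proof. by move=> c u v; apply: scalerDr. Qed.

Fact restrict_scaleDl v : {morph restrict_scale^~ v : a b / a + b}.
Proof. by move=> a b; rewrite /restrict_scale !scalerDl. Qed.

HB.instance Definition _ := GRing.Zmodule_isLmodule.Build F V_F
  restrict_scaleA restrict_scale1 restrict_scaleDr restrict_scaleDl.

Lemma restrict_scaleE (c : F) (v : V_F) : c *: v = (c%:A : E) *: (v : V).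
Proof. by []. Qed.

End Lmodule.

Section Lie.

Variable g : lieAlgType E.
Local Notation g_F := (restrict_scalars E g).

Definition restrict_lie (x y : g_F) : g_F := [< (x : g), (y : g) >].

Fact restrict_lie_linearl z a x y :
  restrict_lie (a *: x + y) z = a *: restrict_lie x z + restrict_lie y z.
Proof. exact: (@lie_linearl E g). Qed.

Fact restrict_lie_linearr z a x y :
  restrict_lie z (a *: x + y) = a *: restrict_lie z x + restrict_lie z y.
Proof. exact: (@lie_linearr E g). Qed.

Fact restrict_liexx x : restrict_lie x x = 0.
Proof. exact: (@liexx E g). Qed.

Fact restrict_jacobi x y z :
  restrict_lie x (restrict_lie y z) + restrict_lie y (restrict_lie z x)
  + restrict_lie z (restrict_lie x y) = 0.
Proof. exact: (@lie_jacobi E g). Qed.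

HB.instance Definition _ := Lmodule_isLieAlgebra.Build F g_F
  restrict_lie_linearl restrict_lie_linearr restrict_liexx restrict_jacobi.

End Lie.

End RestrictScalars.

(* The extension of scalars m (x)_F E of a finite-dimensional m, in coordinates:
   with (b_i) the F-basis [vbasis fullv] of m, the E-module m (x)_F E is free on
   the b_i (x) 1, and the row u stands for the sum of the b_i (x) u_i.  The
   lemmas [tens_lie], [tens_universal] and [tens_ext] below check that this is
   the tensor product, with bracket [x (x) a, y (x) b] = [x, y] (x) ab. *)
Definition extend_scalars (F : fieldType) (E : fieldExtType F)
  (m : vectType F) : Type := 'rV[E]_(\dim {:m}).
Arguments extend_scalars [F] E m.

Section ExtendScalars.

Variables (F : fieldType) (E : fieldExtType F).

Section Vector.

Variable m : vectType F.
Local Notation n := (\dim {:m}).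
Local Notation b := (vbasis {:m}).
Local Notation m_E := (extend_scalars E m).

HB.instance Definition _ := Vector.on m_E.

Definition tens (x : m) (a : E) : m_E := \row_i (coord b i x *: a).

Lemma tens_linearl (a : E) (c : F) (x y : m) :
  tens (c *: x + y) a = (c%:A : E) *: tens x a + tens y a.
Proof.
by apply/rowP=> i; rewrite !mxE linearP scalerDl -scalerA -scalerAl mul1r.
Qed.

Lemma tens_linearr (x : m) (c a a' : E) :
  tens x (c * a + a') = c *: tens x a + tens x a'.
Proof. by apply/rowP=> i; rewrite !mxE scalerDr scalerAr. Qed.

Lemma tensDl x y a : tens (x + y) a = tens x a + tens y a.
Proof. by rewrite -[x]scale1r tens_linearl !scale1r. Qed.

Lemma tens0l a : tens 0 a = 0.
Proof. by apply/rowP=> i; rewrite !mxE linear0 scale0r. Qed.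

Lemma tensZl c x a : tens (c *: x) a = (c%:A : E) *: tens x a.
Proof. by rewrite -[c *: x]addr0 tens_linearl tens0l addr0. Qed.

Lemma tensE x a : tens x a = a *: tens x 1.
Proof. by apply/rowP=> i; rewrite !mxE -scalerAr mulr1. Qed.

Lemma tens_suml I (r : seq I) (P : pred I) (u : I -> m) a :
  tens (\sum_(i <- r | P i) u i) a = \sum_(i <- r | P i) tens (u i) a.
Proof.
by apply: (big_morph (tens^~ a) (fun x y => tensDl x y a) (tens0l a)).
Qed.

Lemma tens_coord (u : m_E) : u = \sum_i u 0 i *: tens b`_i 1.
Proof.
apply/rowP=> j; rewrite summxE (bigD1 j) //= big1 => [|i ne_ij]; last first.
  rewrite !mxE coord_free ?(basis_free (vbasisP _)) // (negPf ne_ij).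
  by rewrite scale0r mulr0.
by rewrite !mxE coord_free ?(basis_free (vbasisP _)) // eqxx scale1r mulr1 addr0.
Qed.

Lemma tens_ext (W : lmodType E) (f1 f2 : {linear m_E -> W}) :
  (forall x a, f1 (tens x a) = f2 (tens x a)) -> f1 =1 f2.
Proof.
move=> eq_f u; rewrite (tens_coord u) !linear_sum; apply: eq_bigr => i _.
by rewrite !linearZ eq_f.
Qed.

Lemma tens_universal (W : lmodType E) (f : {linear m -> restrict_scalars E W}) :
  exists fE : {linear m_E -> W}, forall x a, fE (tens x a) = a *: (f x : W).
Proof.
pose h (u : m_E) : W := \sum_i u 0 i *: (f b`_i : W).
have h_lin : linear h.
  move=> c u v; rewrite /h scaler_sumr -big_split; apply: eq_bigr => i _ /=.
  by rewrite !mxE scalerDl scalerA.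
pose hM := GRing.isLinear.Build E m_E W _ h h_lin.
pose hL : {linear m_E -> W} := HB.pack h hM.
exists hL => x a; rewrite /= /h [in RHS](coord_vbasis (memvf x)) linear_sum.
rewrite (scaler_sumr a); apply: eq_bigr => i _; rewrite linearZ /=.
by rewrite mxE restrict_scaleE scalerA -scalerAr mulr1.
Qed.

End Vector.

Section Lie.

Variable m : finLieAlgType F.
Local Notation b := (vbasis {:m}).
Local Notation m_E := (extend_scalars E m).

Definition extend_lie (u v : m_E) : m_E :=
  \sum_i \sum_j (u 0 i * v 0 j) *: tens [< b`_i, b`_j >] 1.

Lemma tens_lie (x y : m) (a c : E) :
  extend_lie (tens x a) (tens y c) = tens [< x, y >] (a * c).
Proof.
rewrite [in RHS](coord_vbasis (memvf x)) [in RHS](coord_vbasis (memvf y)).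
rewrite lie_suml tens_suml; apply: eq_bigr => i _.
rewrite lie_sumr tens_suml; apply: eq_bigr => j _.
rewrite lieZl lieZr !tensZl !mxE [tens _ (a * c)]tensE !scalerA.
by rewrite -[in RHS]mulrA !mulr_algl -scalerAl -scalerAr.
Qed.

Fact extend_lie_linearl w c u v :
  extend_lie (c *: u + v) w = c *: extend_lie u w + extend_lie v w.
Proof.
rewrite /extend_lie scaler_sumr -big_split; apply: eq_bigr => i _ /=.
rewrite scaler_sumr -big_split; apply: eq_bigr => j _ /=.
by rewrite !mxE mulrDl scalerDl scalerA mulrA.
Qed.

Fact extend_lie_linearr w c u v :
  extend_lie w (c *: u + v) = c *: extend_lie w u + extend_lie w v.
Proof.
rewrite /extend_lie scaler_sumr -big_split; apply: eq_bigr => i _ /=.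
rewrite scaler_sumr -big_split; apply: eq_bigr => j _ /=.
by rewrite !mxE mulrDr scalerDl scalerA mulrCA.
Qed.

Fact extend_liexx u : extend_lie u u = 0.
Proof.
pose f i j : m_E := (u 0 i * u 0 j) *: tens [< b`_i, b`_j >] 1.
have fC i j : f i j = - f j i.
  rewrite /f [u 0 i * _]mulrC [[< b`_i, _ >]]lieNC -scaleN1r tensZl scaleN1r.
  by rewrite scaleN1r scalerN.
have f0 i : f i i = 0 by rewrite /f liexx tens0l scaler0.
have splitf (i : 'I_(\dim {:m})) :
    \sum_j f i j = \sum_(j < _ | (j < i)%N) f i j + \sum_(j < _ | (i < j)%N) f i j.
  rewrite (bigID (fun j : 'I__ => (j < i)%N)) /=; congr (_ + _).
  rewrite (bigD1 i) ?ltnn //= f0 add0r; apply: eq_bigl => j.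
  by rewrite -leqNgt ltn_neqAle andbC eq_sym.
rewrite /extend_lie (eq_bigr _ (fun i _ => splitf i)) big_split /=.
rewrite addrC (exchange_big_dep predT) //= -big_split big1 // => i _ /=.
rewrite -big_split big1 // => j _ /=.
by rewrite fC addNr.
Qed.

Fact extend_lie_triple u v w :
  extend_lie u (extend_lie v w) =
  \sum_i \sum_j \sum_k
    (u 0 i * v 0 j * w 0 k) *: tens [< b`_i, [< b`_j, b`_k >] >] 1.
Proof.
have lieD x y z : extend_lie x (y + z) = extend_lie x y + extend_lie x z.
  by rewrite -[y]scale1r extend_lie_linearr !scale1r.
have lie0 x : extend_lie x 0 = 0.
  by apply: (addIr (extend_lie x 0)); rewrite -lieD !add0r.
have lieZ x c y : extend_lie x (c *: y) = c *: extend_lie x y.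
  by rewrite -[c *: y]addr0 extend_lie_linearr lie0 addr0.
have lie_sum x I (r : seq I) (t : I -> m_E) :
    extend_lie x (\sum_(i <- r) t i) = \sum_(i <- r) extend_lie x (t i).
  by apply: (big_morph (extend_lie x) (lieD x) (lie0 x)).
have lie_tens (x : m) : extend_lie u (tens x 1) =
    \sum_i u 0 i *: tens [< b`_i, x >] 1.
  rewrite /extend_lie; apply: eq_bigr => i _.
  rewrite {2}(coord_vbasis (memvf x)) lie_sumr tens_suml scaler_sumr.
  apply: eq_bigr => j _; rewrite lieZr tensZl scalerA.
  by rewrite !mxE.
rewrite [extend_lie v w]/extend_lie lie_sum [RHS]exchange_big; apply: eq_bigr => j _ /=.
rewrite lie_sum [RHS]exchange_big; apply: eq_bigr => k _ /=.
rewrite lieZ lie_tens scaler_sumr; apply: eq_bigr => i _.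
by rewrite scalerA mulrC mulrA.
Qed.

Fact extend_jacobi u v w :
  extend_lie u (extend_lie v w) + extend_lie v (extend_lie w u)
  + extend_lie w (extend_lie u v) = 0.
Proof.
rewrite !extend_lie_triple.
rewrite [X in _ + X + _](eq_bigr _ (fun i _ => exchange_big _ _ _ _ _ _)) /=.
rewrite [X in _ + X + _]exchange_big /= [X in _ + _ + X]exchange_big /=.
rewrite -!big_split big1 // => i _ /=.
rewrite [X in _ + _ + X]exchange_big /= -!big_split big1 // => j _ /=.
rewrite -!big_split big1 // => k _ /=.
have -> : v 0 j * w 0 k * u 0 i = u 0 i * v 0 j * w 0 k.
  by rewrite mulrC mulrA.
have -> : w 0 k * u 0 i * v 0 j = u 0 i * v 0 j * w 0 k.
  by rewrite -mulrA mulrC.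
by rewrite -!scalerDr -!tensDl lie_jacobi tens0l scaler0.
Qed.

HB.instance Definition _ := Lmodule_isLieAlgebra.Build E m_E
  extend_lie_linearl extend_lie_linearr extend_liexx extend_jacobi.

End Lie.

End ExtendScalars.

(* There is no loss in taking m finite-dimensional, since
   \dim_F m = \dim_E (m (x)_F E) = \dim_E g. *)
Definition defined_over (F : fieldType) (E : fieldExtType F)
    (g : finLieAlgType E) : Prop :=
  exists m : finLieAlgType F, lie_isomorphic g (extend_scalars E m).
Arguments defined_over F [E] g.

(* Main.v *)
Require Import Defs.
From HB Require Import structures.
From mathcomp Require Import all_boot all_fingroup all_algebra all_field.
From Stdlib Require Import Classical_Prop.

(* Let G = Gal(E / F).  By independence of characters, an F-linear map phi
   between E-spaces is a unique sum of s-semilinear components phi_s, s in G.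
   If phi : g -> h is an isomorphism of Lie algebras over F with inverse psi,
   uniqueness shows that each phi_s preserves brackets, that distinct components
   have commuting images, and that sum_s psi_(r s^-1) phi_s is 1 for r = 1 and
   0 otherwise.  As g is defined over F, G acts on g by semilinear automorphisms
   theta_s.
   If g is indecomposable, the endomorphisms psi_(s^-1) phi_s of the adjoint
   module g sum to 1, so one of them is bijective by Fitting's lemma, and
   phi_s theta_s^-1 is an E-isomorphism g -> h.
   If h too is defined over F, with action eta, then the matrix with entries
   eta_r phi_(r^-1 t) theta_t^-1 is an E-isomorphism g^G -> h^G, and g is
   isomorphic to h by the Krull-Schmidt theorem for ideal decompositions. *)

Set Implicit Arguments.
Unset Strict Implicit.
Unset Printing Implicit Defensive.

Import GRing.Theory.
Local Open Scope ring_scope.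

(** * Isomorphisms, products and ideals of Lie algebras *)

(** Bare functions shown to be linear become elements of ['Hom], where kernels, images and dimension
    counts are available. *)
Lemma lfun_of_linear (K : fieldType) (V W : vectType K) (f : V -> W) :
  linear f -> exists u : 'Hom(V, W), u =1 f.
Proof.
move=> f_lin; pose fM := GRing.isLinear.Build K V W _ f f_lin.
by pose fL : {linear V -> W} := HB.pack f fM; exists (linfun fL) => x;
  rewrite lfunE.
Qed.

Section LieIsomorphisms.

Variable K : fieldType.
Implicit Types g h k : lieAlgType K.

Lemma lie_isoI g h (f : g -> h) (f' : h -> g) :
    linear f -> cancel f f' -> cancel f' f ->
    (forall x y, f [< x, y >] = [< f x, f y >]) ->
  lie_isomorphic g h.
Proof.
move=> f_lin fK f'K f_lie; pose fM := GRing.isLinear.Build K g h _ f f_lin.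
pose fL : {linear g -> h} := HB.pack f fM.
by exists fL; split=> //; exists f'.
Qed.

Lemma lie_isoE g h : lie_isomorphic g h ->
  exists (f : {linear g -> h}) (f' : {linear h -> g}),
    [/\ cancel f f', cancel f' f, forall x y, f [< x, y >] = [< f x, f y >]
      & forall x y, f' [< x, y >] = [< f' x, f' y >]].
Proof.
case=> f [[f' fK f'K] f_lie].
have f'_lin : linear f' by move=> a x y;
  rewrite -{1}[x]f'K -{1}[y]f'K -linearP fK.
pose fM := GRing.isLinear.Build K h g _ f' f'_lin.
pose f'L : {linear h -> g} := HB.pack f' fM.
exists f, f'L; split=> //= x y.
by rewrite -{1}[x]f'K -{1}[y]f'K -f_lie fK.
Qed.

Lemma lie_iso_refl g : lie_isomorphic g g.
Proof. exact: (@lie_isoI g g id id). Qed.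

Lemma lie_iso_sym g h : lie_isomorphic g h -> lie_isomorphic h g.
Proof.
case/lie_isoE=> f [f' [fK f'K _ f'_lie]].
by apply: (@lie_isoI _ _ f' f) => //; apply: linearP.
Qed.

Lemma lie_iso_trans g h k :
  lie_isomorphic g h -> lie_isomorphic h k -> lie_isomorphic g k.
Proof.
case/lie_isoE=> f [f' [fK f'K f_lie _]] /lie_isoE[e [e' [eK e'K e_lie _]]].
apply: (@lie_isoI _ _ (e \o f) (f' \o e')); first exact: linearP.
- exact: can_comp.
- exact: can_comp.
by move=> x y /=; rewrite f_lie e_lie.
Qed.

End LieIsomorphisms.

Section Product.

Variable K : fieldType.

Section Structure.

Variables g h : lieAlgType K.

Definition prod_lie (x y : g * h) : g * h := ([< x.1, y.1 >], [< x.2, y.2 >]).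

Fact prod_lie_linearl z a x y :
  prod_lie (a *: x + y) z = a *: prod_lie x z + prod_lie y z.
Proof. by congr (_, _); rewrite /= lie_linearl. Qed.

Fact prod_lie_linearr z a x y :
  prod_lie z (a *: x + y) = a *: prod_lie z x + prod_lie z y.
Proof. by congr (_, _); rewrite /= lie_linearr. Qed.

Fact prod_liexx x : prod_lie x x = 0.
Proof. by congr (_, _); rewrite liexx. Qed.

Fact prod_jacobi x y z :
  prod_lie x (prod_lie y z) + prod_lie y (prod_lie z x)
  + prod_lie z (prod_lie x y) = 0.
Proof. by congr (_, _); rewrite /= lie_jacobi. Qed.

HB.instance Definition _ := Lmodule_isLieAlgebra.Build K (g * h)%type
  prod_lie_linearl prod_lie_linearr prod_liexx prod_jacobi.

Lemma prod_lieE (x y : g * h) : [< x, y >] = ([< x.1, y.1 >], [< x.2, y.2 >]).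
Proof. by []. Qed.

End Structure.

HB.instance Definition _ (g h : finLieAlgType K) := Vector.on (g * h)%type.

Lemma dim_prod (g h : finLieAlgType K) :
  \dim {: (g * h)%type} = (\dim {:g} + \dim {:h})%N.
Proof. by rewrite !dimvf. Qed.

Lemma prod_isoC (g h : lieAlgType K) : lie_isomorphic (g * h)%type (h * g)%type.
Proof.
by apply: (@lie_isoI _ _ _ (fun x => (x.2, x.1)) (fun x => (x.2, x.1))) => //
  -[].
Qed.

Lemma prod_isoA (g h k : lieAlgType K) :
  lie_isomorphic (g * (h * k))%type (g * h * k)%type.
Proof.
by apply: (@lie_isoI _ _ _ (fun x => ((x.1, x.2.1), x.2.2))
  (fun x => (x.1.1, (x.1.2, x.2)))) => // [[? []]|[[]]].
Qed.

Lemma prod_iso (g g' h h' : lieAlgType K) :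
    lie_isomorphic g g' -> lie_isomorphic h h' ->
  lie_isomorphic (g * h)%type (g' * h')%type.
Proof.
case/lie_isoE=> f [f' [fK f'K f_lie _]] /lie_isoE[e [e' [eK e'K e_lie _]]].
apply: (@lie_isoI _ _ _ (fun x => (f x.1, e x.2)) (fun x => (f' x.1, e' x.2))).
- by move=> a x y /=; congr (_, _); rewrite linearP.
- by case=> x y /=; rewrite fK eK.
- by case=> x y /=; rewrite f'K e'K.
by move=> x y; rewrite !prod_lieE /= f_lie e_lie.
Qed.

End Product.

Section Power.

Variables (K : fieldType).

Section Structure.

Variables (I : finType) (g : lieAlgType K).

Definition ffun_lie (x y : {ffun I -> g}) : {ffun I -> g} :=
  [ffun i => [< x i, y i >]].

Fact ffun_lie_linearl z a x y :
  ffun_lie (a *: x + y) z = a *: ffun_lie x z + ffun_lie y z.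
Proof. by apply/ffunP=> i; rewrite !ffunE lie_linearl. Qed.

Fact ffun_lie_linearr z a x y :
  ffun_lie z (a *: x + y) = a *: ffun_lie z x + ffun_lie z y.
Proof. by apply/ffunP=> i; rewrite !ffunE lie_linearr. Qed.

Fact ffun_liexx x : ffun_lie x x = 0.
Proof. by apply/ffunP=> i; rewrite !ffunE liexx. Qed.

Fact ffun_jacobi x y z :
  ffun_lie x (ffun_lie y z) + ffun_lie y (ffun_lie z x)
  + ffun_lie z (ffun_lie x y) = 0.
Proof. by apply/ffunP=> i; rewrite !ffunE lie_jacobi. Qed.

HB.instance Definition _ := Lmodule_isLieAlgebra.Build K {ffun I -> g}
  ffun_lie_linearl ffun_lie_linearr ffun_liexx ffun_jacobi.

Lemma ffun_lieE (x y : {ffun I -> g}) i : [< x, y >] i = [< x i, y i >].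
Proof. by rewrite ffunE. Qed.

End Structure.

HB.instance Definition _ (I : finType) (g : finLieAlgType K) :=
  Vector.on {ffun I -> g}.

Lemma dim_ffun (I : finType) (g : finLieAlgType K) :
  \dim {: {ffun I -> g}} = (#|I| * \dim {:g})%N.
Proof. by rewrite !dimvf. Qed.

Lemma ffun_iso_bij (I J : finType) (f : I -> J) (g : lieAlgType K) :
  bijective f -> lie_isomorphic {ffun J -> g} {ffun I -> g}.
Proof.
case=> f' fK f'K.
apply: (@lie_isoI K {ffun J -> g} {ffun I -> g} (fun x => [ffun i => x (f i)])
  (fun x => [ffun j => x (f' j)])).
- by move=> a x y; apply/ffunP=> i; rewrite !ffunE.
- by move=> x; apply/ffunP=> i; rewrite !ffunE f'K.
- by move=> x; apply/ffunP=> i; rewrite !ffunE fK.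
by move=> x y; apply/ffunP=> i; rewrite !ffunE.
Qed.

Lemma ffun_isoS n (g : lieAlgType K) :
  lie_isomorphic {ffun 'I_n.+1 -> g} (g * {ffun 'I_n -> g})%type.
Proof.
apply: (@lie_isoI K {ffun 'I_n.+1 -> g} (g * {ffun 'I_n -> g})%type
  (fun x => (x ord0, [ffun i => x (lift ord0 i)]))
  (fun x => [ffun i => if unlift ord0 i is Some j then x.2 j else x.1])).
- by move=> a x y; congr (_, _); [|apply/ffunP=> i]; rewrite !ffunE.
- move=> x; apply/ffunP=> i; rewrite ffunE /=.
  by case: unliftP => [j|] -> //; rewrite ffunE.
- case=> x y; congr (_, _); first by rewrite ffunE unlift_none.
  by apply/ffunP=> i; rewrite !ffunE liftK.
by move=> x y; congr (_, _); [|apply/ffunP=> i]; rewrite !ffunE.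
Qed.

Lemma ffun_iso_prod (I : finType) (g h : lieAlgType K) :
  lie_isomorphic {ffun I -> (g * h)%type} ({ffun I -> g} * {ffun I -> h})%type.
Proof.
apply: (@lie_isoI K {ffun I -> (g * h)%type}
  ({ffun I -> g} * {ffun I -> h})%type
  (fun x => ([ffun i => (x i).1], [ffun i => (x i).2]))
  (fun x => [ffun i => (x.1 i, x.2 i)])).
- by move=> a x y; congr (_, _); apply/ffunP=> i; rewrite !ffunE.
- by move=> x; apply/ffunP=> i; rewrite !ffunE; case: (x i).
- by case=> x y; congr (_, _); apply/ffunP=> i; rewrite !ffunE.
by move=> x y; congr (_, _); apply/ffunP=> i; rewrite !ffunE.
Qed.

Lemma ffun_iso (I : finType) (g h : lieAlgType K) :
  lie_isomorphic g h -> lie_isomorphic {ffun I -> g} {ffun I -> h}.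
Proof.
case/lie_isoE=> f [f' [fK f'K f_lie _]].
apply: (@lie_isoI K {ffun I -> g} {ffun I -> h} (fun x => [ffun i => f (x i)])
  (fun x => [ffun i => f' (x i)])).
- by move=> a x y; apply/ffunP=> i; rewrite !ffunE linearP.
- by move=> x; apply/ffunP=> i; rewrite !ffunE fK.
- by move=> x; apply/ffunP=> i; rewrite !ffunE f'K.
by move=> x y; apply/ffunP=> i; rewrite !ffunE f_lie.
Qed.

End Power.

(** * Ideals as Lie algebras, and Fitting's lemma *)

Section Ideals.

Variables (K : fieldType) (g : finLieAlgType K).

(** The type is indexed by the proof [idI], so that the bracket inherited from [g] can be attached
    to it as a canonical structure. *)
Definition ideal_sub (I : {vspace g}) (idI : lie_ideal I) : Type := subvs_of I.

Section Structure.

Variables (I : {vspace g}) (idI : lie_ideal I).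
Local Notation S := (ideal_sub idI).

HB.instance Definition _ := Vector.on S.

Definition sub_lie (x y : S) : S := Subvs (idI (vsval x) (subvsP y)).

Fact sub_lie_linearl z a x y :
  sub_lie (a *: x + y) z = a *: sub_lie x z + sub_lie y z.
Proof. by apply: val_inj; rewrite /= lie_linearl. Qed.

Fact sub_lie_linearr z a x y :
  sub_lie z (a *: x + y) = a *: sub_lie z x + sub_lie z y.
Proof. by apply: val_inj; rewrite /= lie_linearr. Qed.

Fact sub_liexx x : sub_lie x x = 0.
Proof. by apply: val_inj; rewrite /= liexx. Qed.

Fact sub_jacobi x y z :
  sub_lie x (sub_lie y z) + sub_lie y (sub_lie z x)
  + sub_lie z (sub_lie x y) = 0.
Proof. by apply: val_inj; rewrite /= lie_jacobi. Qed.

HB.instance Definition _ := Lmodule_isLieAlgebra.Build K S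
  sub_lie_linearl sub_lie_linearr sub_liexx sub_jacobi.

Lemma dim_ideal_sub : \dim {: S} = \dim I.
Proof. by rewrite dimvf. Qed.

End Structure.

(** A bracket of an element of [I] with an element of [J] lies in [I :&: J = 0], so the sum map from
    the product preserves brackets; its inverse is given by the two projections. *)
Lemma direct_ideals_iso (I J : {vspace g}) (idI : lie_ideal I) (idJ : lie_ideal
  J) :
    (I + J)%VS = fullv -> directv (I + J) ->
  lie_isomorphic g (ideal_sub idI * ideal_sub idJ)%type.
Proof.
move=> sIJ /directv_addP dIJ.
have lieIJ x y : x \in I -> y \in J -> [< x, y >] = 0.
  move=> Ix Jy; apply/eqP; rewrite -memv0 -dIJ memv_cap idJ // andbT.
  by rewrite lieNC memvN idI.
have dJI : (J :&: I)%VS = 0%VS by rewrite capvC.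
have pi0 U V v : (U :&: V)%VS = 0%VS -> v \in V -> daddv_pi U V v = 0.
  move=> dUV Vv; apply: (addIr v);
    rewrite add0r -{2}[v](daddv_pi_id (U := V) (V := U)) 1?capvC //.
  by rewrite daddv_pi_add // -[v]add0r memv_add ?mem0v.
apply: lie_iso_sym.
apply: (@lie_isoI K (ideal_sub idI * ideal_sub idJ)%type g
  (fun u => vsval u.1 + vsval u.2)
  (fun x => (vsproj I (daddv_pi I J x), vsproj J (daddv_pi J I x)))).
- by move=> a u v /=; rewrite scalerDr addrACA.
- case=> x y; congr (_, _); apply: val_inj; rewrite /= linearD /=.
    by rewrite daddv_pi_id ?subvsP // pi0 ?subvsP // addr0 vsprojK ?subvsP.
  by rewrite [X in _ + X]daddv_pi_id ?subvsP // pi0 ?subvsP // add0r vsprojK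
    ?subvsP.
- by move=> x; rewrite /= !vsprojK ?memv_pi // daddv_pi_add // sIJ memvf.
move=> u v /=; rewrite lieDl !lieDr [[< vsval u.2, vsval v.1 >]]lieNC.
rewrite (lieIJ (vsval u.1) (vsval v.2)) ?subvsP //.
by rewrite (lieIJ (vsval v.1)) ?subvsP // oppr0 addr0 add0r.
Qed.

(** Powers of [e] commute with the adjoint maps, so their kernels and images are ideals. Once the
    rank of [e^n] is stable, [g] is the direct sum of the kernel and image of [e^n], and
    indecomposability makes one of them all of [g]. *)
Lemma fitting (e : 'End(g)) :
    indecomposable g -> (forall x y, [< x, e y >] = e [< x, y >]) ->
  lker e == 0%VS \/ exists n, forall x, iter n e x = 0.
Proof.
move=> indec_g e_ad.
pose p n : 'End(g) := iter n (fun u => (e \o u)%VF) \1%VF.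
have pE n x : p n x = iter n e x.
  by elim: n => [|n IHn] /=; rewrite lfunE //= IHn.
have p_ad n x y : [< x, p n y >] = p n [< x, y >].
  by rewrite !pE; elim: n => //= n <-.
have pD (m n : nat) : limg (p (m + n)) = (p m @: limg (p n))%VS.
  rewrite -limg_comp; congr (limg _); apply/lfunP=> x.
  by rewrite comp_lfunE !pE iterD.
have dimp n : (\dim (limg (p (n + n))) <= \dim (limg (p n)))%N.
  by rewrite pD -[leqRHS](limg_ker_dim (p n)) leq_addl.
(* Doubling the exponent lowers the rank until it stabilises, whence the induction on a bound [d]
   for the rank. Positivity of [n] is what later lets injectivity of [e^n] pass to [e]. *)
have [n n_gt0 dim_n] : exists2 n, (0 < n)%N & \dim (limg (p (n + n))) = \dim
  (limg (p n)).
  suffices stab d n : (0 < n)%N -> (\dim (limg (p n)) <= d)%N ->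
      exists2 n, (0 < n)%N & \dim (limg (p (n + n))) = \dim (limg (p n)).
    exact: (stab _ 1).
  elim: d n => [|d IHd] n n_gt0 le_d.
    exists n => //; apply/eqP; rewrite eqn_leq dimp; move: le_d.
    by rewrite leqn0 => /eqP->.
  have [eq_dim|neq_dim] := eqVneq (\dim (limg (p (n + n)))) (\dim (limg (p n))).
    by exists n.
  by apply: (IHd (n + n)%N); rewrite ?addn_gt0 ?n_gt0 // -ltnS (leq_trans _
    le_d) // ltn_neqAle neq_dim dimp.
(* Rank-nullity for [p n] restricted to its own image, which it maps onto the image of [p (n + n)],
   of the same dimension. *)
have dIJ : (lker (p n) :&: limg (p n))%VS = 0%VS.
  apply/eqP; rewrite capvC -dimv_eq0 -(eqn_add2r (\dim (limg (p n)))) add0n.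
  by rewrite -[X in (_ + X)%N]dim_n pD limg_ker_dim.
have sIJ : (lker (p n) + limg (p n))%VS = fullv.
  apply/eqP; rewrite eqEdim subvf dimv_disjoint_sum //.
  by rewrite -(limg_ker_dim (p n) fullv) capfv leqnn.
have [full_ker|ker_neq] := eqVneq (lker (p n)) fullv.
  right; exists n => x; apply/eqP; rewrite -pE -memv_ker full_ker.
  exact: memvf.
left; have [full_lim|lim_neq] := eqVneq (limg (p n)) fullv.
  have kp0 : lker (p n) == 0%VS.
    by rewrite -dIJ full_lim capvf.
  apply/lker0P=> x y eq_e; apply: (lker0P kp0); rewrite !pE -(prednK n_gt0).
  by rewrite !iterSr eq_e.
case: indec_g; exists (lker (p n)), (limg (p n)); split=> //;
  last exact/directv_addP.
- by split=> // x y; rewrite !memv_ker -p_ad => /eqP->; rewrite lie0r.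
- by split=> // x _ /memv_imgP[y _ ->]; rewrite p_ad memv_img ?memvf.
Qed.

End Ideals.

(** * Cancellation of powers *)

Section KrullSchmidt.

Variable K : fieldType.
Implicit Types A U g h X Y Z : finLieAlgType K.

(** With [u = e1 + e2] invertible, Fitting's lemma applies to [u^-1 e1]. If this is nilpotent, then
    [e2] is injective, because [u^-1 e1] fixes every vector killed by [e2]. *)
Lemma fitting_add A (e1 e2 : 'End(A)) :
    indecomposable A ->
    (forall x y, [< x, e1 y >] = e1 [< x, y >]) ->
    (forall x y, [< x, e2 y >] = e2 [< x, y >]) ->
    lker (e1 + e2) == 0%VS ->
  lker e1 == 0%VS \/ lker e2 == 0%VS.
Proof.
move=> indecA e1_ad e2_ad ker0; set u := e1 + e2 in ker0.
have uVK : cancel (u^-1)%VF u by exact: lker0_lfunVK.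
have uK : cancel u (u^-1)%VF by exact: lker0_lfunK.
have u_ad x y : [< x, u y >] = u [< x, y >].
  by rewrite /u !add_lfunE lieDr e1_ad e2_ad.
have uV_ad x y : [< x, (u^-1)%VF y >] = (u^-1)%VF [< x, y >].
  by apply: (can_inj uK); rewrite -u_ad !uVK.
have [|ker1|[n nil1]] := @fitting K A (u^-1 \o e1)%VF indecA.
- by move=> x y; rewrite !comp_lfunE uV_ad e1_ad.
- left; apply/lker0P=> x y eq_e; apply: (lker0P ker1).
  by rewrite !comp_lfunE eq_e.
right; rewrite -subv0; apply/subvP=> x; rewrite memv_ker memv0 => /eqP e2x0.
have fix1 : (u^-1 \o e1)%VF x = x.
  by rewrite comp_lfunE -[e1 x]addr0 -e2x0 -add_lfunE uK.
by rewrite -(nil1 x); elim: (n) => //= m /eqP <-; rewrite fix1.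
Qed.

(* With [iY : A -> Y] and [pY : Y -> A] the components of [f] and [f'], the
   hypothesis is that [pY \o iY] is bijective.  Then [D := ker pY] complements
   [iY A] in [Y], and [D * Z] complements [f A] in [Y * Z]. *)
Lemma exchange_bij A X Y Z (f : {linear (A * X)%type -> (Y * Z)%type})
    (f' : {linear (Y * Z)%type -> (A * X)%type}) :
    cancel f f' -> cancel f' f -> (forall x y, f [< x, y >] = [< f x, f y >]) ->
    bijective (fun a => (f' ((f (a, 0)).1, 0)).1) ->
  exists D : finLieAlgType K,
    lie_isomorphic Y (A * D)%type /\ lie_isomorphic X (D * Z)%type.
Proof.
move=> fK f'K f_lie.
have f'_lie x y : f' [< x, y >] = [< f' x, f' y >].
  by rewrite -{1}[x]f'K -{1}[y]f'K -f_lie fK.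
pose iY a := (f (a, 0)).1; pose pY y := (f' (y, 0)).1.
case=> e' eK e'K.
have eK' a : e' (pY (iY a)) = a := eK a.
have e'K' a : pY (iY (e' a)) = a := e'K a.
have iY_lin : linear iY.
  move=> c a b; rewrite /iY -(linearP (fst : _ -> Y)) -linearP.
  by congr (f (_, _)).1; rewrite /= scaler0 addr0.
have pY_lin : linear pY.
  move=> c a b; rewrite /pY -(linearP (fst : _ -> A)) -linearP.
  by congr (f' (_, _)).1; rewrite /= scaler0 addr0.
have [P PE] := lfun_of_linear pY_lin.
have pY_lie x y : pY [< x, y >] = [< pY x, pY y >].
  rewrite /pY -[RHS]/([< f' (x, 0), f' (y, 0) >].1) -f'_lie.
  by rewrite prod_lieE /= liexx.
have iY_lie x y : iY [< x, y >] = [< iY x, iY y >].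
  rewrite /iY -[RHS]/([< f (x, 0), f (y, 0) >].1) -f_lie.
  by rewrite prod_lieE /= liexx.
have idP : lie_ideal (lker P).
  by move=> x y; rewrite !memv_ker !PE pY_lie => /eqP->; rewrite lie0r.
have P_sub (d : ideal_sub idP) : pY (vsval d) = 0.
  by apply/eqP; rewrite -PE -memv_ker subvsP.
(* The element [f' (vsval d, 0)] has [A]-component [pY (vsval d) = 0], so it commutes with [(a, 0)];
   applying [f] gives the claim. *)
have iY_sub a (d : ideal_sub idP) : [< iY a, vsval d >] = 0.
  rewrite /iY -[LHS]/([< f (a, 0), (vsval d, 0) >].1).
  rewrite -[(vsval d, 0)]f'K -f_lie prod_lieE.
  rewrite -[(f' (vsval d, 0)).1]/(pY (vsval d)) P_sub.
  by rewrite lie0r lie0l linear0.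
have pYB a b : pY (a - b) = pY a - pY b by rewrite -!PE linearB.
have pYD a b : pY (a + b) = pY a + pY b by rewrite -!PE linearD.
have iYN a : iY (- a) = - iY a.
  by have [Q QE] := lfun_of_linear iY_lin; rewrite -!QE linearN.
(* Since [e'] inverts [pY \o iY], the map [iY \o e' \o pY] is the projection onto the image of [iY]
   along the kernel of [pY]. *)
have ker_mod y : y - iY (e' (pY y)) \in lker P.
  by rewrite memv_ker PE pYB e'K' subrr.
have subE (d : ideal_sub idP) y : y = vsval d -> vsproj (lker P) y = d.
  by move=> ->; apply: vsvalK.
exists (ideal_sub idP); split.
  apply: lie_iso_sym.
  apply: (@lie_isoI K (A * ideal_sub idP)%type Y (fun u => iY u.1 + vsval u.2)
     (fun y => (e' (pY y), vsproj (lker P) (y - iY (e' (pY y)))))).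
  - by move=> c u v /=; rewrite iY_lin scalerDr addrACA.
  - case=> a d /=; rewrite pYD P_sub addr0 eK'; congr (_, _); apply: subE.
    by rewrite addrAC subrr add0r.
  - by move=> y /=; rewrite vsprojK // addrC subrK.
  move=> u v /=; rewrite iY_lie lieDl !lieDr iY_sub addr0.
  by rewrite [[< vsval u.2, iY v.1 >]]lieNC iY_sub oppr0 add0r.
have f_split (w : (Y * Z)%type) : f (0, (f' w).2) = w - f ((f' w).1, 0).
  rewrite -{2}[w]f'K -linearB /=; congr (f _); case: (f' w) => a x.
  by congr (_, _); rewrite /= ?subrr ?subr0.
apply: lie_iso_sym.
(* [r x] is the element [a] of [A] for which [f (0, x) - f (a, 0)] has its [Y]-component in the
   kernel of [pY]. Such a correction changes only the [A]-component, so [f'] still returns [x] in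
   [X]. *)
pose r x := e' (pY (f (0, x)).1).
apply: (@lie_isoI K (ideal_sub idP * Z)%type X
  (fun u => (f' (vsval u.1, u.2)).2)
  (fun x => (vsproj (lker P) ((f (0, x)).1 - iY (r x)),
             (f (0, x)).2 - (f (r x, 0)).2))).
- move=> c u v.
  by rewrite -[RHS]/((c *: f' (vsval u.1, u.2) + f' (vsval v.1, v.2)).2)
    -linearP.
- case=> d z /=.
  have r_eq : r (f' (vsval d, z)).2 = - (f' (vsval d, z)).1.
    apply: (can_inj eK'); rewrite /r e'K' f_split /= pYB P_sub sub0r iYN.
    by rewrite -!PE linearN.
  rewrite r_eq f_split iYN opprK /= subrK vsvalK; congr (_, _).
  have fN b : f (- b, 0) = - f (b, 0).
    by rewrite -linearN; congr (f (_, _)); rewrite /= oppr0.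
  by rewrite fN /= opprK subrK.
- move=> x /=; rewrite vsprojK //.
  have -> : ((f (0, x)).1 - iY (r x), (f (0, x)).2 - (f (r x, 0)).2)
      = f (0, x) - f (r x, 0) by [].
  by rewrite linearB !fK /= subr0.
move=> u v /=.
by rewrite -[RHS]/([< f' (vsval u.1, u.2), f' (vsval v.1, v.2) >].2) -f'_lie.
Qed.

(** The identity of [A] factors through [Y * Z], hence is the sum of an endomorphism through [Y] and
    one through [Z]. By [fitting_add] one of the two is bijective, and [A] splits off the
    corresponding factor. *)
Lemma exchange A X Y Z :
    indecomposable A -> lie_isomorphic (A * X)%type (Y * Z)%type ->
  (exists D : finLieAlgType K,
    lie_isomorphic Y (A * D)%type /\ lie_isomorphic X (D * Z)%type) \/
  (exists D : finLieAlgType K,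
    lie_isomorphic Z (A * D)%type /\ lie_isomorphic X (D * Y)%type).
Proof.
move=> indecA; case/lie_isoE=> f [f' [fK f'K f_lie f'_lie]].
have f1D c a b : f (c *: a + b, 0) = c *: f (a, 0) + f (b, 0).
  by rewrite -linearP; congr (f (_, _)); rewrite /= scaler0 addr0.
have f_lie1 a b : f ([< a, b >], 0) = [< f (a, 0), f (b, 0) >].
  by rewrite -f_lie prod_lieE /= liexx.
have eY_lin : linear (fun a => (f' ((f (a, 0)).1, 0)).1).
  move=> c a b; rewrite -[RHS]/((c *: f' ((f (a, 0)).1, 0) + f' ((f (b, 0)).1,
    0)).1).
  by rewrite -linearP f1D; congr (f' (_, _)).1; rewrite /= scaler0 addr0.
have eZ_lin : linear (fun a => (f' (0, (f (a, 0)).2)).1).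
  move=> c a b; rewrite -[RHS]/((c *: f' (0, (f (a, 0)).2) + f' (0, (f (b,
    0)).2)).1).
  by rewrite -linearP f1D; congr (f' (_, _)).1; rewrite /= scaler0 addr0.
have [eY eYE] := lfun_of_linear eY_lin; have [eZ eZE] := lfun_of_linear eZ_lin.
have [|||kY|kZ] := @fitting_add A eY eZ indecA.
(* Write [(x, 0)] as [f' (f (x, 0))]: bracketing with [f (x, 0)] acts separately on the two factors
   [Y] and [Z], so it commutes with the truncation to [Y]. *)
- move=> x y; rewrite !eYE f_lie1 -[LHS]/([< (x, 0), f' ((f (y, 0)).1, 0) >].1).
  by rewrite -{1}[(x, 0)]fK -f'_lie prod_lieE /= lie0r.
- move=> x y; rewrite !eZE f_lie1 -[LHS]/([< (x, 0), f' (0, (f (y, 0)).2) >].1).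
  by rewrite -{1}[(x, 0)]fK -f'_lie prod_lieE /= lie0r.
- apply/lker0P=> x y; suffices e_id a : (eY + eZ) a = a by rewrite !e_id.
  rewrite add_lfunE eYE eZE.
  rewrite -[LHS]/((f' ((f (a, 0)).1, 0) + f' (0, (f (a, 0)).2)).1) -linearD.
  have -> : ((f (a, 0)).1, 0) + (0, (f (a, 0)).2) = f (a, 0).
    by case: (f (a, 0)) => u v; congr (_, _); rewrite /= ?addr0 ?add0r.
  by rewrite fK.
- left; apply: (@exchange_bij A X Y Z f f' fK f'K f_lie).
  exists (eY^-1)%VF => x; rewrite -eYE; first exact: lker0_lfunK.
  exact: lker0_lfunVK.
(* [s] and [s'] are [f] and [f'] with the factors [Y] and [Z] interchanged, which reduces this case
   to [exchange_bij]. *)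
right; pose s x := ((f x).2, (f x).1);
  pose s' (x : (Z * Y)%type) := f' (x.2, x.1).
have s_lin : linear s by move=> c x y; rewrite /s linearP.
have s'_lin : linear s' by move=> c x y; rewrite /s' -linearP.
pose sM := GRing.isLinear.Build K (A * X)%type (Z * Y)%type _ s s_lin.
pose s'M := GRing.isLinear.Build K (Z * Y)%type (A * X)%type _ s' s'_lin.
pose sL : {linear (A * X)%type -> (Z * Y)%type} := HB.pack s sM.
pose s'L : {linear (Z * Y)%type -> (A * X)%type} := HB.pack s' s'M.
apply: (@exchange_bij A X Z Y sL s'L).
- by move=> x; rewrite /= /s /s' -surjective_pairing fK.
- by case=> x y; rewrite /= /s /s' f'K.
- by move=> x y; rewrite /= /s f_lie.
exists (eZ^-1)%VF => x; rewrite /= /s /s' /= -eZE; first exact: lker0_lfunK.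
exact: lker0_lfunVK.
Qed.

Lemma dim0_eq0 g (x : g) : \dim {:g} = 0%N -> x = 0.
Proof.
by move/eqP; rewrite dimv_eq0 => /eqP g0; apply/eqP; rewrite -memv0 -g0 memvf.
Qed.

Lemma dim0_iso g h : \dim {:g} = 0%N -> \dim {:h} = 0%N -> lie_isomorphic g h.
Proof.
move=> g0 h0; apply: (@lie_isoI K g h (fun=> 0) (fun=> 0)).
- by move=> c x y; rewrite scaler0 addr0.
- by move=> x; rewrite (dim0_eq0 x g0).
- by move=> x; rewrite (dim0_eq0 x h0).
by move=> x y; rewrite lie0l.
Qed.

Lemma dim0_prod_iso U g : \dim {:U} = 0%N -> lie_isomorphic (U * g)%type g.
Proof.
move=> U0; apply: (@lie_isoI K (U * g)%type g snd (fun x => (0, x))) => //.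
by case=> u x; rewrite (dim0_eq0 u U0).
Qed.

Lemma lie_iso_dim g h : lie_isomorphic g h -> \dim {:g} = \dim {:h}.
Proof.
suffices dim_leq g' h' : lie_isomorphic g' h' -> (\dim {:g'} <= \dim {:h'})%N.
  by move=> gh; apply/eqP; rewrite eqn_leq !dim_leq //; apply: lie_iso_sym.
case/lie_isoE=> f [f' [fK _ _ _]].
have /lker0P ker0 : injective (linfun f).
  by move=> x y; rewrite !lfunE => /(can_inj fK).
rewrite -(limg_dim_eq (f := linfun f)) ?dimvS ?subvf //.
by rewrite (eqP ker0) capv0.
Qed.

(** Exchange either gives [A] isomorphic to [A * D], where the dimension forces [D = 0], or shows
    that both [X] and [Y] are products of [A] and [D]. *)
Lemma cancel_indecomposable A X Y : indecomposable A ->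
  lie_isomorphic (A * X)%type (A * Y)%type -> lie_isomorphic X Y.
Proof.
move=> indecA /(exchange indecA)[][D [isoA isoX]]; last first.
  apply: lie_iso_trans isoX _; apply: lie_iso_trans (prod_isoC _ _) _.
  exact: lie_iso_sym.
apply: lie_iso_trans isoX _; apply: dim0_prod_iso.
have := @lie_iso_dim A (A * D)%type isoA;
  rewrite dim_prod -[in LHS](addn0 (\dim _)).
by move/addnI->.
Qed.

(** Induction on the dimension. The zero algebra counts as indecomposable, so [A] is separately
    required to be nonzero. *)
Lemma indecomposable_summand g : \dim {:g} != 0%N ->
  exists A X, [/\ indecomposable A, \dim {:A} != 0%N & lie_isomorphic g (A *
    X)%type].
Proof.
have [d] := ubnP (\dim {:g}); elim: d g => // d IHd g le_gd g_neq0.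
have [decg|indecg] := classic (decomposable g); last first.
  (* The empty power serves as the zero algebra. *)
  exists g, {ffun 'I_0 -> g}; split=> //; apply: lie_iso_sym.
  apply: lie_iso_trans (prod_isoC _ _) _; apply: dim0_prod_iso.
  by rewrite dim_ffun card_ord mul0n.
case: decg => I [J [[idI ltI] [idJ ltJ] sIJ dIJ]].
have gIJ := direct_ideals_iso idI idJ sIJ dIJ.
have dim_lt (U : {vspace g}) : U != fullv -> (\dim U < \dim {:g})%N.
  by move=> ltU; rewrite ltn_neqAle dimvS ?subvf // andbT (dimv_leqif_eq (subvf
    U)).
have [||A [X [indecA A_neq0 isoI]]] := IHd (ideal_sub idI).
- by rewrite dim_ideal_sub (leq_trans (dim_lt _ ltI)).
- rewrite dim_ideal_sub dimv_eq0; apply: contraNneq ltJ => I0.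
  by rewrite -sIJ I0 add0v.
exists A, (X * ideal_sub idJ)%type; split=> //.
apply: lie_iso_trans gIJ _;
  apply: lie_iso_trans (lie_iso_sym (prod_isoA _ _ _)).
exact: prod_iso isoI (lie_iso_refl _).
Qed.

(** Exchange against [h * h^n] puts [A] either in [h] or in the smaller power; the descent must stop
    in [h], since the empty power has dimension zero and [A] does not. *)
Lemma summand_ffun A h n X : indecomposable A -> \dim {:A} != 0%N ->
    lie_isomorphic (A * X)%type {ffun 'I_n -> h} ->
  exists Y : finLieAlgType K, lie_isomorphic h (A * Y)%type.
Proof.
move=> indecA A_neq0; elim: n X => [|n IHn] X isoAX.
  have := @lie_iso_dim (A * X)%type {ffun 'I_0 -> h} isoAX;
    rewrite dim_prod dim_ffun card_ord mul0n => /eqP.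
  by rewrite addn_eq0 (negPf A_neq0).
case/(exchange indecA): (lie_iso_trans isoAX (ffun_isoS n h)) => -[D [isoA _]].
  by exists D.
exact: IHn D (lie_iso_sym isoA).
Qed.

Lemma cancel_ffun A n X Y : indecomposable A ->
    lie_isomorphic ({ffun 'I_n -> A} * X)%type ({ffun 'I_n -> A} * Y)%type ->
  lie_isomorphic X Y.
Proof.
move=> indecA; elim: n X Y => [|n IHn] X Y isoXY.
  have A0 : \dim {: {ffun 'I_0 -> A}} = 0%N by rewrite dim_ffun card_ord mul0n.
  apply: lie_iso_trans (lie_iso_sym (dim0_prod_iso X A0)) _.
  exact: lie_iso_trans isoXY (dim0_prod_iso Y A0).
have split_iso Z : lie_isomorphic ({ffun 'I_n.+1 -> A} * Z)%type
    (A * ({ffun 'I_n -> A} * Z))%type.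
  apply: lie_iso_trans (lie_iso_sym (prod_isoA _ _ _)).
  exact: prod_iso (ffun_isoS n A) (lie_iso_refl Z).
apply/IHn/(cancel_indecomposable indecA).
apply: lie_iso_trans (lie_iso_sym (split_iso X)) _.
exact: lie_iso_trans isoXY (split_iso Y).
Qed.

(** Induction on the dimension of [g]. A nonzero indecomposable summand [A] of [g] is a summand of
    the power of [h], hence of [h]; cancelling the power of [A] leaves powers of the two
    complements, the one in [g] being of smaller dimension. *)
Lemma ffun_iso_inj n g h : (0 < n)%N ->
  lie_isomorphic {ffun 'I_n -> g} {ffun 'I_n -> h} -> lie_isomorphic g h.
Proof.
case: n => // n _; have [d] := ubnP (\dim {:g});
  elim: d g h => // d IHd g h le_gd isogh.
have [g0|g_neq0] := eqVneq (\dim {:g}) 0%N.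
  apply: dim0_iso => //; move: (@lie_iso_dim {ffun 'I_n.+1 -> g} {ffun 'I_n.+1
    -> h} isogh).
  by rewrite !dim_ffun card_ord g0 muln0 => /esym/eqP; rewrite muln_eq0 => /eqP.
have [A [X [indecA A_neq0 gAX]]] := indecomposable_summand g_neq0.
have [Y hAY] : exists Y : finLieAlgType K, lie_isomorphic h (A * Y)%type.
  apply: (@summand_ffun A h n.+1 (X * {ffun 'I_n -> g})%type indecA A_neq0).
  apply: lie_iso_trans (prod_isoA _ _ _) _; apply: lie_iso_trans isogh.
  apply: lie_iso_trans (lie_iso_sym (ffun_isoS n g)).
  exact: prod_iso (lie_iso_sym gAX) (lie_iso_refl _).
have split_iso k Z : lie_isomorphic k (A * Z)%type ->
    lie_isomorphic {ffun 'I_n.+1 -> k} ({ffun 'I_n.+1 -> A} * {ffun 'I_n.+1 ->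
      Z})%type.
  by move=> isok; apply: lie_iso_trans (ffun_iso _ isok) (ffun_iso_prod _ _ _).
apply: lie_iso_trans (gAX) _; apply: lie_iso_trans (lie_iso_sym hAY).
apply: prod_iso (lie_iso_refl A) _; apply: IHd.
  move: le_gd; rewrite (@lie_iso_dim g (A * X)%type gAX) dim_prod ltnS;
    apply: leq_trans.
  by rewrite -[X in (X < _)%N]add0n ltn_add2r lt0n.
apply: (cancel_ffun indecA);
  apply: lie_iso_trans (lie_iso_sym (split_iso _ _ gAX)) _.
exact: lie_iso_trans isogh (split_iso _ _ hAY).
Qed.

End KrullSchmidt.

(** * Semilinear components of an F-linear map *)

(** A faithful action of an abstract finite group on [E] by field automorphisms over [F];
    [gala_card] expresses that the extension is Galois. *)
Record galois_action (F : fieldType) (E : fieldExtType F) (G : finGroupType)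
    (act : G -> {rmorphism E -> E}) : Prop := GaloisAction {
  gala_fix : forall s (c : F), act s c%:A = c%:A;
  gala_inj : forall s t, act s =1 act t -> s = t;
  gala1 : forall a, act 1%g a = a;
  galaM : forall s t a, act (s * t)%g a = act s (act t a);
  gala_card : #|G| = \dim {:E} }.

(** The automorphisms enumerated by [s] are closed under composition and inverse, so composition
    makes [seq_sub s] a finite group. *)
Lemma galois_actionP (F : fieldType) (E : fieldExtType F) :
  galois_extension F E ->
  exists (G : finGroupType) (act : G -> {rmorphism E -> E}), galois_action act.
Proof.
case=> s [s_uniq s_mem s_size].
have morph (x : seq_sub s) : monoid_morphism (val x).
  by apply/kHom_monoid_morphism; rewrite -kAutfE -s_mem; apply: ssvalP.
have morph1 (x : seq_sub s) : val x 1 = 1 := (morph x).1.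
have morphM (x : seq_sub s) a b : val x (a * b) = val x a * val x b := (morph
  x).2 a b.
have ker0 (x : seq_sub s) : lker (val x) == 0%VS.
  by apply: kAutf_lker0; apply/kHom_monoid_morphism/morph.
have comp_mem (x y : seq_sub s) : (val x \o val y)%VF \in s.
  rewrite s_mem kAutfE; apply/kHom_monoid_morphism; split=> [|a b].
    by rewrite comp_lfunE !morph1.
  by rewrite !comp_lfunE !morphM.
have id_mem : \1%VF \in s by rewrite s_mem kAutfE kHom1.
have inv_mem (x : seq_sub s) : ((val x)^-1)%VF \in s.
  rewrite s_mem kAutfE; apply/kHom_monoid_morphism;
    have xK := lker0_lfunK (ker0 x).
  have xVK : cancel _ (val x) := lker0_lfunVK (ker0 x).
  split=> [|a b]; apply: (can_inj xK); rewrite ?morph1 ?morphM !xVK //.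
pose mul x y : seq_sub s := SeqSub (comp_mem x y).
pose one : seq_sub s := SeqSub id_mem.
pose inv x : seq_sub s := SeqSub (inv_mem x).
have mulA : associative mul by move=> x y z; apply: val_inj;
  rewrite /= comp_lfunA.
have mul1 : left_id one mul by move=> x; apply: val_inj; rewrite /= comp_lfun1l.
have mulV : left_inverse one inv mul.
  by move=> x; apply: val_inj; rewrite /= lker0_compVf ?ker0.
pose grM := Finite_isGroup.Build (seq_sub s) mulA mul1 mulV.
pose G : finGroupType := HB.pack (seq_sub s) grM.
pose actM (x : seq_sub s) := GRing.isMonoidMorphism.Build E E (val x) (morph x).
pose act (x : G) : {rmorphism E -> E} := HB.pack (fun_of_lfun (val (x : seq_sub
  s))) (actM x).
exists G, act; split.
- move=> x c; rewrite /act /= linearZ /=; congr (_ *: _); exact: (morph x).1.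
- by move=> x y eq_xy; apply/val_inj/lfunP.
- by move=> a; rewrite /act /= id_lfunE.
- by move=> x y a; rewrite /act /= comp_lfunE.
by rewrite card_seq_sub.
Qed.

Section GaloisAction.

Variables (F : fieldType) (E : fieldExtType F) (G : finGroupType).
Variables (act : G -> {rmorphism E -> E}) (act_gal : galois_action act).

Lemma act_scale s (c : F) (a : E) : act s (c *: a) = c *: act s a.
Proof. by rewrite -mulr_algl rmorphM (gala_fix act_gal) mulr_algl. Qed.

(** Dedekind's independence of characters, with vectors as coefficients, by induction on the list of
    automorphisms involved. *)
Lemma act_independent (V : lmodType E) (u : G -> V) :
  (forall a, \sum_s act s a *: u s = 0) -> forall s, u s = 0.
Proof.
suffices indep (r : seq G) : uniq r -> forall u : G -> V,
    (forall a, \sum_(s <- r) act s a *: u s = 0) -> {in r, forall s, u s = 0}.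
  move=> u0 s; apply: (indep (index_enum G)) => //;
    first exact: index_enum_uniq.
  exact: mem_index_enum.
elim: r => // s r IHr /= /andP[s_nin r_uniq] {}u u0.
have u_r : {in r, forall t, u t = 0}.
  move=> t rt; have [b neq_b] : exists b, act t b != act s b.
    apply: NNPP => eq_ts; case/negP: s_nin; suffices <- : t = s by [].
    apply: (gala_inj act_gal) => b; apply: NNPP => /eqP neq_b.
    by case: eq_ts; exists b.
  have {}u0 a : \sum_(i <- r) act i a *: u i = - (act s a *: u s).
    by have := u0 a; rewrite big_cons addrC => /eqP; rewrite addr_eq0 => /eqP.
  suffices /eqP : (act t b - act s b) *: u t = 0.
    by rewrite scaler_eq0 subr_eq0 (negPf neq_b) => /eqP.
  (* The relation at [a * b] minus [act s b] times the relation at [a] has no [s] term, and its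
     coefficients are those given here. *)
  apply: (IHr r_uniq (fun t => (act t b - act s b) *: u t)) => // a.
  transitivity (\sum_(i <- r) act i (a * b) *: u i
      - act s b *: \sum_(i <- r) act i a *: u i).
    rewrite scaler_sumr -sumrB; apply: eq_bigr => i _.
    by rewrite rmorphM scalerA mulrBr scalerBl scalerA [act s b * _]mulrC.
  by rewrite !u0 scalerN scalerA rmorphM [act s b * _]mulrC subrr.
move=> t; rewrite inE => /predU1P[->|/u_r//].
have := u0 1; rewrite big_cons big1_seq => [|i /andP[_ /u_r->]];
  last exact: scaler0.
by rewrite rmorph1 scale1r addr0.
Qed.

Lemma act_ext (V : lmodType E) (u v : G -> V) :
  (forall a, \sum_s act s a *: u s = \sum_s act s a *: v s) -> u =1 v.
Proof.
move=> eq_uv s; apply/eqP; rewrite -subr_eq0; apply/eqP.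
apply: (act_independent (u := fun s => u s - v s)) => a.
by rewrite (eq_bigr _ (fun s _ => scalerBr _ _ _)) sumrB eq_uv subrr.
Qed.

(** The matrix of all [act s] on a basis of [E] is square by [gala_card], and its rows are
    independent by independence of characters; [N] is read off a left inverse. *)
Lemma act_dual_basis : exists N : 'I_(\dim {:E}) -> G -> E,
  forall i j : 'I_(\dim {:E}), \sum_s act s (vbasis {:E})`_j * N i s = (i ==
    j)%:R.
Proof.
pose M := \matrix_(k < #|G|, j < \dim {:E}) act (enum_val k) (vbasis {:E})`_j.
have : row_full M.
  rewrite /row_full -{2}(gala_card act_gal) -/(row_free M);
    apply: inj_row_free => v vM0.
  apply/rowP=> k; rewrite mxE -(enum_valK k).
  (* Scalars are taken as vectors of [E^o], so that [act_independent] applies to the row [v]. *)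
  pose u s : E^o := v 0 (enum_rank s).
  apply: (@act_independent _ u _ (enum_val k)) => a.
  rewrite (coord_vbasis (memvf a)).
  have act_sum s : act s (\sum_j coord (vbasis {:E}) j a *: (vbasis {:E})`_j)
      = \sum_j coord (vbasis {:E}) j a *: act s (vbasis {:E})`_j.
    by rewrite rmorph_sum; apply: eq_bigr => j _; rewrite act_scale.
  transitivity (\sum_j coord (vbasis {:E}) j a *: (v *m M) 0 j); last first.
    by rewrite vM0 big1 // => j _; rewrite mxE scaler0.
  transitivity (\sum_s \sum_j coord (vbasis {:E}) j a *: (act s (vbasis
    {:E})`_j * u s)).
    apply: eq_bigr => s _; rewrite act_sum scaler_suml; apply: eq_bigr => j _.
    by rewrite -[LHS]/((_ *: _) * _) scalerAl.
  rewrite exchange_big; apply: eq_bigr => j _ /=.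
  rewrite mxE scaler_sumr (reindex (@enum_val G G)) /=;
    last exact/onW_bij/enum_val_bij.
  by apply: eq_bigr => i _; rewrite /u enum_valK mxE [v _ _ * _]mulrC.
case/row_fullP=> B BM; exists (fun i s => B i (enum_rank s)) => i j.
move/matrixP/(_ i j): BM; rewrite !mxE => <-.
rewrite (reindex (@enum_val G G)) /=; last exact/onW_bij/enum_val_bij.
by apply: eq_bigr => k _; rewrite enum_valK !mxE mulrC.
Qed.

(** The components solve the linear system obtained by letting [a] run over a basis of [E], with [N]
    as inverse matrix; linearity over [F] extends the identity to every [a]. *)
Lemma act_decomposition (V W : lmodType E) (phi : V -> W) :
    {morph phi : x y / x + y} ->
    (forall (c : F) x, phi (c%:A *: x) = c%:A *: phi x) ->
  exists f : G -> V -> W, forall a x, phi (a *: x) = \sum_s act s a *: f s x.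
Proof.
move=> phiD phiZ; have [N NE] := act_dual_basis.
pose b : (\dim {:E}).-tuple E := vbasis {:E}.
have phi0 : phi 0 = 0 by apply: (addIr (phi 0)); rewrite -phiD !add0r.
exists (fun s x => \sum_i N i s *: phi (b`_i *: x)) => a x.
have phi_b (j : 'I_(\dim {:E})) : phi (b`_j *: x) = \sum_s act s b`_j *: \sum_i
  N i s *: phi (b`_i *: x).
  under eq_bigr do rewrite scaler_sumr; rewrite exchange_big (bigD1 j) //=.
  under eq_bigr do rewrite scalerA; rewrite -scaler_suml NE eqxx scale1r.
  rewrite big1 ?addr0 // => i neq_ij; under eq_bigr do rewrite scalerA.
  by rewrite -scaler_suml NE (negPf neq_ij) scale0r.
rewrite {1}(coord_vbasis (memvf a)) scaler_suml (big_morph phi phiD phi0).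
rewrite (eq_bigr (fun j => \sum_s act s (coord b j a *: b`_j)
    *: \sum_i N i s *: phi (b`_i *: x))) => [|j _]; last first.
  rewrite -mulr_algl -scalerA phiZ phi_b scaler_sumr; apply: eq_bigr => s _.
  by rewrite rmorphM (gala_fix act_gal) scalerA.
rewrite exchange_big; apply: eq_bigr => s _.
by rewrite -scaler_suml -rmorph_sum -(coord_vbasis (memvf a)).
Qed.

Definition act_linear (V W : lmodType E) s (f : V -> W) : Prop :=
  forall a x y, f (a *: x + y) = act s a *: f x + f y.

Section SemilinearMaps.

Variables (V W : lmodType E) (s : G) (f : V -> W).
Hypothesis f_lin : act_linear s f.

Lemma act_linearD : {morph f : x y / x + y}.
Proof. by move=> x y; rewrite -[x]scale1r f_lin rmorph1 !scale1r. Qed.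

Lemma act_linear0 : f 0 = 0.
Proof. by apply: (addIr (f 0)); rewrite -act_linearD !add0r. Qed.

Lemma act_linear_sum I (r : seq I) (P : pred I) (u : I -> V) :
  f (\sum_(i <- r | P i) u i) = \sum_(i <- r | P i) f (u i).
Proof. exact: (big_morph f act_linearD act_linear0). Qed.

End SemilinearMaps.

Section Components.

Variables (V W : lmodType E) (phi : V -> W) (f : G -> V -> W).
Hypothesis phiE : forall a x, phi (a *: x) = \sum_s act s a *: f s x.

(** Compare the coefficients of [act s b] in the expansions of [phi (b *: (a *: x + y))]. *)
Lemma act_linear_components : {morph phi : x y / x + y} -> forall s, act_linear
  s (f s).
Proof.
move=> phiD s a x y; move: s.
apply: (act_ext (u := fun s => f s (a *: x + y))) => b.
rewrite -phiE scalerDr phiD scalerA !phiE -big_split; apply: eq_bigr => s _ /=.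
by rewrite scalerDr scalerA rmorphM.
Qed.

(** Expand [psi (phi (a *: x)) = a *: x]. The composite of [k t] and [f s] carries the coefficient
    [act (t * s) a], while the right-hand side has only the component at [1]. *)
Lemma components_comp (psi : W -> V) (k : G -> W -> V) :
    {morph psi : x y / x + y} ->
    (forall a x, psi (a *: x) = \sum_s act s a *: k s x) -> cancel phi psi ->
  forall r x, \sum_s k (r * s^-1)%g (f s x) = if r == 1%g then x else 0.
Proof.
move=> psiD psiE phiK r x; move: r.
apply: (act_ext (u := fun r => \sum_s k (r * s^-1)%g (f s x))) => a.
have psi0 : psi 0 = 0 by apply: (addIr (psi 0)); rewrite -psiD !add0r.
transitivity (a *: x); last first.
  rewrite (bigD1 1%g) //= eqxx (gala1 act_gal) big1 ?addr0 // => r /negPf->.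
  exact: scaler0.
rewrite -[RHS]phiK phiE (big_morph psi psiD psi0).
under [LHS]eq_bigr do rewrite scaler_sumr.
rewrite exchange_big; apply: eq_bigr => s _ /=.
rewrite psiE (reindex_inj (mulIg s)); apply: eq_bigr => t _ /=.
by rewrite mulgK (galaM act_gal).
Qed.

End Components.

(** Expand [phi [< a *: x, b *: y >]] in two ways: [act s a * act t b] occurs for all pairs on one
    side and only for [s = t] on the other. Independence is applied in [b], then in [a]. *)
Lemma components_lie (g h : lieAlgType E) (phi : g -> h) (f : G -> g -> h) :
    (forall a x, phi (a *: x) = \sum_s act s a *: f s x) ->
    (forall x y, phi [< x, y >] = [< phi x, phi y >]) ->
  forall s t x y, [< f s x, f t y >] = if s == t then f s [< x, y >] else 0.
Proof.
move=> phiE phi_lie s t x y; move: t.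
apply: (act_ext (u := fun t => [< f s x, f t y >])) => b.
transitivity (act s b *: f s [< x, y >]); last first.
  rewrite (bigD1 s) //= eqxx big1 ?addr0 // => t; rewrite eq_sym => /negPf->.
  exact: scaler0.
move: s; apply: (act_ext (u := fun s => \sum_t act t b *: [< f s x, f t y >]))
  => a.
transitivity (phi ((a * b) *: [< x, y >])); last first.
  by rewrite phiE; apply: eq_bigr => s _; rewrite rmorphM scalerA.
rewrite -scalerA -lieZr -lieZl phi_lie !phiE lie_suml; apply: eq_bigr => s _.
rewrite lie_sumr scaler_sumr; apply: eq_bigr => t _.
by rewrite lieZl lieZr.
Qed.

End GaloisAction.

(** * Descent *)

(** Iterates [fitting_add]. A nonempty [r] supplies an index even when [A] is zero and the empty sum
    is injective. *)
Lemma fitting_sum (K : fieldType) (A : finLieAlgType K) (I : eqType) (r : seq I)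
    (e : I -> 'End(A)) :
    indecomposable A -> (forall i x y, [< x, e i y >] = e i [< x, y >]) ->
    r != [::] -> lker (\sum_(i <- r) e i) == 0%VS ->
  exists i, lker (e i) == 0%VS.
Proof.
move=> indecA e_ad; elim: r => // i [|j r] IHr _.
  by rewrite big_seq1; exists i.
rewrite big_cons => /(fitting_add indecA (e_ad i))[||/IHr]; last exact.
  move=> x y; rewrite !sum_lfunE lie_sumr; exact: eq_bigr.
by exists i.
Qed.

(** In bases over [E], [phi] becomes an injective [F]-linear map from [E^p] to [E^q]. Comparing
    dimensions over [F] and dividing by the degree of [E] gives [p <= q]. *)
Lemma restrict_dim_leq (F : fieldType) (E : fieldExtType F) (V W : vectType E)
    (phi : V -> W) :
    {morph phi : x y / x + y} ->
    (forall (c : F) x, phi (c%:A *: x) = c%:A *: phi x) -> injective phi ->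
  (\dim {:V} <= \dim {:W})%N.
Proof.
move=> phiD phiZ phi_inj.
pose p := \dim {:V}; pose q := \dim {:W}.
pose vec (x : {ffun 'I_p -> E}) : V := \sum_i x i *: (vbasis {:V})`_i.
pose u (x : {ffun 'I_p -> E}) : {ffun 'I_q -> E} :=
  [ffun j => coord (vbasis {:W}) j (phi (vec x))].
have vec_lin c x y : vec (c *: x + y) = c%:A *: vec x + vec y.
  rewrite /vec scaler_sumr -big_split; apply: eq_bigr => i _ /=.
  by rewrite !ffunE scalerDl scalerA mulr_algl.
have u_lin : linear u.
  move=> c x y; apply/ffunP=> j; rewrite !ffunE vec_lin phiD phiZ linearP.
  by congr (_ + _); apply: mulr_algl.
have [U UE] := lfun_of_linear u_lin.
have kerU : lker U == 0%VS.
  apply/lker0P=> x y; rewrite !UE => /ffunP eq_u.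
  have /phi_inj eq_vec : phi (vec x) = phi (vec y).
    rewrite (coord_vbasis (memvf (phi (vec x)))) (coord_vbasis (memvf (phi (vec
      y)))).
    by apply: eq_bigr => j _; have := eq_u j; rewrite !ffunE => ->.
  apply/ffunP=> i; have := congr1 (coord (vbasis {:V}) i) eq_vec.
  by rewrite !coord_sum_free ?(basis_free (vbasisP _)).
have dimE n : \dim {: {ffun 'I_n -> E}} = (n * \dim {:E})%N.
  by rewrite !dimvf /dim /= card_ord.
suffices : (\dim {: {ffun 'I_p -> E}} <= \dim {: {ffun 'I_q -> E}})%N.
  by rewrite !dimE leq_pmul2r ?adim_gt0.
by rewrite -(limg_dim_eq (f := U)) ?dimvS ?subvf // (eqP kerU) capv0.
Qed.

(** * Semilinear Galois actions and twisted matrices *)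

Section SemilinearActions.

Variables (F : fieldType) (E : fieldExtType F) (G : finGroupType).
Variables (act : G -> {rmorphism E -> E}) (act_gal : galois_action act).

(** The descent datum carried by an algebra defined over [F]. *)
Record lie_semilinear_action (g : lieAlgType E) (theta : G -> g -> g) : Prop :=
  LieSemilinearAction {
    sact_lin : forall s, act_linear act s (theta s);
    sact_lie : forall s x y, theta s [< x, y >] = [< theta s x, theta s y >];
    sact1 : theta 1%g =1 id;
    sactM : forall s t, theta (s * t)%g =1 theta s \o theta t }.

(** The group acts on coordinates. It respects the bracket because the structure constants come from
    [F] and are fixed. *)
Lemma extend_scalars_action (m : finLieAlgType F) :
  exists theta : G -> extend_scalars E m -> extend_scalars E m,
    lie_semilinear_action theta.
Proof.
exists (fun s => map_mx (act s)); split.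
- by move=> s a x y; apply/rowP=> i; rewrite !mxE rmorphD rmorphM.
- move=> s x y; rewrite /lie /= /extend_lie raddf_sum; apply: eq_bigr => i _.
  rewrite raddf_sum; apply: eq_bigr => j _; apply/rowP=> k.
  by rewrite !mxE; apply: (etrans (rmorphM _ _ _));
    rewrite rmorphM (gala_fix act_gal).
- by move=> x; apply/rowP=> i; rewrite !mxE (gala1 act_gal).
by move=> s t x; apply/rowP=> i; rewrite !mxE (galaM act_gal).
Qed.

Lemma defined_over_action (g : finLieAlgType E) :
  defined_over F g -> exists theta : G -> g -> g, lie_semilinear_action theta.
Proof.
case=> m /lie_isoE[f [f' [fK f'K f_lie f'_lie]]].
have [theta [th_lin th_lie th1 thM]] := extend_scalars_action m.
exists (fun s x => f' (theta s (f x))); split.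
- by move=> s a x y; rewrite linearP th_lin linearP.
- by move=> s x y; rewrite f_lie th_lie f'_lie.
- by move=> x; rewrite th1 fK.
by move=> s t x; rewrite /= f'K thM.
Qed.

Section Twist.

Variables (g h : lieAlgType E) (theta : G -> g -> g) (eta : G -> h -> h).
Hypotheses (thetaP : lie_semilinear_action theta) (etaP : lie_semilinear_action
  eta).

Lemma sactK s : cancel (theta s) (theta s^-1%g).
Proof. by move=> x; rewrite -[LHS](sactM thetaP) mulVg (sact1 thetaP). Qed.

Lemma sactKV s : cancel (theta s^-1%g) (theta s).
Proof. by move=> x; rewrite -[LHS](sactM thetaP) mulgV (sact1 thetaP). Qed.

Lemma act_linear_twist (phi : g -> h) r s t :
  act_linear act s phi -> (r * s * t = 1)%g ->
  linear (fun x => eta r (phi (theta t x))).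
Proof.
move=> phi_lin rst1 a x y; rewrite (sact_lin thetaP) phi_lin (sact_lin etaP).
by rewrite -!(galaM act_gal) rst1 (gala1 act_gal).
Qed.

(* The [(r, t)] entry [eta r \o f (r^-1 * t) \o theta t^-1] is linear, since the
   three semilinearities cancel. *)
Definition twist (f : G -> g -> h) (w : {ffun G -> g}) : {ffun G -> h} :=
  [ffun r => \sum_t eta r (f (r^-1 * t)%g (theta t^-1%g (w t)))].

Lemma twist_linear f : (forall s, act_linear act s (f s)) -> linear (twist f).
Proof.
move=> f_lin a v w; apply/ffunP=> r; rewrite !ffunE scaler_sumr -big_split.
apply: eq_bigr => t _ /=; rewrite !ffunE.
by rewrite (act_linear_twist (f_lin _)) // mulKVg mulgV.
Qed.

(** Within row [r], the entries at distinct columns involve distinct components of [f], so their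
    images commute and the cross terms vanish. *)
Lemma twist_lie f :
    (forall s t x y, [< f s x, f t y >] = if s == t then f s [< x, y >] else 0)
      ->
  forall v w, twist f [< v, w >] = [< twist f v, twist f w >].
Proof.
move=> f_lie v w; apply/ffunP=> r; rewrite ffun_lieE !ffunE lie_suml.
apply: eq_bigr => t _; rewrite lie_sumr (bigD1 t) //= big1 ?addr0 => [|t'
  neq_t].
  by rewrite -(sact_lie etaP) f_lie eqxx ffun_lieE (sact_lie thetaP).
rewrite -(sact_lie etaP) f_lie (inj_eq (mulgI _)) eq_sym (negPf neq_t).
exact: act_linear0 (sact_lin etaP r).
Qed.

End Twist.

(** A matrix product: in each entry [eta r] cancels, and what is left is the composition identity
    for components at [t^-1 * t']. *)
Lemma twistK (g h : lieAlgType E) (theta : G -> g -> g) (eta : G -> h -> h)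
    (f : G -> g -> h) (k : G -> h -> g) :
    lie_semilinear_action theta -> lie_semilinear_action eta ->
    (forall s, act_linear act s (k s)) ->
    (forall r x, \sum_s k (r * s^-1)%g (f s x) = if r == 1%g then x else 0) ->
  cancel (twist theta eta f) (twist eta theta k).
Proof.
move=> thetaP etaP k_lin kf w; apply/ffunP=> t; rewrite ffunE.
transitivity (\sum_r \sum_t' theta t (k (t^-1 * r)%g (f (r^-1 * t')%g (theta
  t'^-1%g (w t'))))).
  apply: eq_bigr => r _; rewrite ffunE (act_linear_sum (sact_lin etaP _)).
  rewrite (act_linear_sum (k_lin _)) (act_linear_sum (sact_lin thetaP _)).
  by apply: eq_bigr => t' _; rewrite (sactK etaP).
have inner t' : \sum_r theta t (k (t^-1 * r)%g (f (r^-1 * t')%g (theta t'^-1%g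
  (w t'))))
    = if t == t' then w t else 0.
  (* The substitution is [r = t' * s^-1], which turns [r^-1 * t'] into [s]. *)
  rewrite (reindex_inj (inj_comp (mulgI t') (@invg_inj G))) /=.
  transitivity (theta t (\sum_s k (t^-1 * t' * s^-1)%g (f s (theta t'^-1%g (w
    t'))))).
    rewrite (act_linear_sum (sact_lin thetaP _)); apply: eq_bigr => s _.
    by rewrite invMg invgK mulgKV mulgA.
  rewrite kf -eq_mulVg1; case: eqP => [ <-|_]; first exact: (sactKV thetaP).
  exact: act_linear0 (sact_lin thetaP t).
rewrite exchange_big; under eq_bigr do rewrite inner.
by rewrite (bigD1 t) //= eqxx big1 ?addr0 // => t' /negPf; rewrite eq_sym => ->.
Qed.

End SemilinearActions.

(** * The two cases of the theorem *)

Lemma lie_iso_components (F : fieldType) (E : fieldExtType F) (G : finGroupType)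
    (act : G -> {rmorphism E -> E}) (g h : lieAlgType E) :
    galois_action act ->
    lie_isomorphic (restrict_scalars E g) (restrict_scalars E h) ->
  exists (f : G -> g -> h) (k : G -> h -> g),
    [/\ (forall s, act_linear act s (f s)) /\ (forall s, act_linear act s (k
      s)),
        forall s t x y, [< f s x, f t y >] = if s == t then f s [< x, y >] else
          0,
        forall s t x y, [< k s x, k t y >] = if s == t then k s [< x, y >] else
          0,
        forall r x, \sum_s k (r * s^-1)%g (f s x) = if r == 1%g then x else 0 &
        forall r x, \sum_s f (r * s^-1)%g (k s x) = if r == 1%g then x else 0].
Proof.
move=> act_gal /lie_isoE[phi [psi [phiK psiK phi_lie psi_lie]]].
have phiD : {morph (phi : g -> h) : x y / x + y} := linearD phi.
have psiD : {morph (psi : h -> g) : x y / x + y} := linearD psi.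
have [f fE] := act_decomposition act_gal phiD (linearZ_LR phi).
have [k kE] := act_decomposition act_gal psiD (linearZ_LR psi).
exists f, k; split.
- by split; [apply: (act_linear_components act_gal fE) | apply:
    (act_linear_components act_gal kE)].
- exact: (components_lie act_gal fE phi_lie).
- exact: (components_lie act_gal kE psi_lie).
- exact: (components_comp act_gal fE psiD kE phiK).
exact: (components_comp act_gal kE phiD fE psiK).
Qed.

Lemma lie_iso_restrict_dim (F : fieldType) (E : fieldExtType F)
    (g h : finLieAlgType E) :
    lie_isomorphic (restrict_scalars E g) (restrict_scalars E h) ->
  \dim {:g} = \dim {:h}.
Proof.
suffices dim_leq (g' h' : finLieAlgType E) :
    lie_isomorphic (restrict_scalars E g') (restrict_scalars E h') ->
    (\dim {:g'} <= \dim {:h'})%N.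
  by move=> iso_gh; apply/eqP; rewrite eqn_leq !dim_leq //; apply: lie_iso_sym.
case/lie_isoE=> phi [psi [phiK _ _ _]].
have phiD : {morph (phi : g' -> h') : x y / x + y} := linearD phi.
exact: (restrict_dim_leq phiD (linearZ_LR phi) (can_inj phiK)).
Qed.

Lemma lie_iso_both_defined (F : fieldType) (E : fieldExtType F)
    (g h : finLieAlgType E) :
    galois_extension F E -> defined_over F g -> defined_over F h ->
    lie_isomorphic (restrict_scalars E g) (restrict_scalars E h) ->
  lie_isomorphic g h.
Proof.
case/galois_actionP=> G [act act_gal].
case/(defined_over_action act_gal)=> theta thetaP.
case/(defined_over_action act_gal)=> eta etaP.
case/(lie_iso_components act_gal)=> f [k [[f_lin k_lin] f_lie k_lie kf fk]].
have G_gt0 : (0 < #|G|)%N by apply/card_gt0P; exists 1%g.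
apply: (ffun_iso_inj G_gt0).
(* Cancellation is available for powers indexed by ordinals, while [twist] acts on powers indexed by
   [G]. *)
have enum_iso (m : finLieAlgType E) :
    lie_isomorphic {ffun G -> m} {ffun 'I_#|G| -> m}.
  exact/ffun_iso_bij/(@enum_val_bij G).
apply: lie_iso_trans (lie_iso_sym (enum_iso g)) _.
apply: lie_iso_trans (enum_iso h).
apply: (@lie_isoI E {ffun G -> g} {ffun G -> h} (twist theta eta f) (twist eta
  theta k)).
- exact: (twist_linear act_gal thetaP etaP f_lin).
- exact: (twistK thetaP etaP k_lin kf).
- exact: (twistK etaP thetaP f_lin fk).
exact: (twist_lie thetaP etaP f_lie).
Qed.

Lemma lie_iso_indecomposable (F : fieldType) (E : fieldExtType F)
    (g h : finLieAlgType E) :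
    galois_extension F E -> defined_over F g -> indecomposable g ->
    lie_isomorphic (restrict_scalars E g) (restrict_scalars E h) ->
  lie_isomorphic g h.
Proof.
case/galois_actionP=> G [act act_gal].
case/(defined_over_action act_gal)=> theta thetaP indec_g iso_gh.
have dim_gh := lie_iso_restrict_dim iso_gh.
have [f [k [[f_lin k_lin] f_lie k_lie kf fk]]] := lie_iso_components act_gal
  iso_gh.
have e_lin s : linear (fun x => k s^-1%g (f s x)).
  by move=> a x y; rewrite f_lin k_lin -(galaM act_gal) mulVg (gala1 act_gal).
have [e eE] : exists e : G -> 'End(g), forall s x, e s x = k s^-1%g (f s x).
  exact: (fin_all_exists (fun s => lfun_of_linear (e_lin s))).
have sum_e x : (\sum_s e s) x = x.
  have := kf 1%g x; rewrite eqxx => {2}<-; rewrite sum_lfunE;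
    apply: eq_bigr => s _.
  by rewrite eE mul1g.
(* Write [x] as the sum of all [e t x]. For [t] other than [s] the bracket with [e s y] vanishes,
   since distinct components of [k] commute; for [t = s] it is [e s [< x, y >]]. *)
have e_ad s x y : [< x, e s y >] = e s [< x, y >].
  rewrite -{1}[x]sum_e sum_lfunE lie_suml (bigD1 s) //= big1 ?addr0 => [|t
    neq_ts].
    by rewrite !eE k_lie eqxx f_lie eqxx.
  by rewrite !eE k_lie (inj_eq invg_inj) (negPf neq_ts).
have [||s kers] := @fitting_sum E g G (index_enum G) e indec_g e_ad.
- by apply: contraTneq (mem_index_enum (1%g : G)) => ->.
- by apply/lker0P=> x y; rewrite !sum_e.
have f_inj : injective (f s).
  by move=> x y eq_f; apply: (lker0P kers); rewrite !eE eq_f.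
pose phi x := f s (theta s^-1%g x).
have phi_lin : linear phi.
  by move=> a x y; rewrite /phi (sact_lin thetaP) f_lin -(galaM act_gal) mulgV
    (gala1 act_gal).
have phi_lie x y : phi [< x, y >] = [< phi x, phi y >].
  by rewrite /phi (sact_lie thetaP) f_lie eqxx.
have [u uE] := lfun_of_linear phi_lin.
have keru : lker u == 0%VS.
  apply/lker0P=> x y; rewrite !uE /phi => /f_inj.
  exact: (can_inj (sactKV thetaP s)).
(* [g] and [h] have the same dimension over [E], so the injective map [u] is onto. *)
have limu : limg u = fullv.
  apply/eqP; rewrite eqEdim subvf /= -dim_gh limg_dim_eq //.
  by rewrite (eqP keru) capv0.
apply: (@lie_isoI E g h u (u^-1)%VF).
- exact: linearP.
- exact: lker0_lfunK.
- by move=> y; apply: limg_lfunVK; rewrite limu memvf.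
by move=> x y; rewrite !uE.
Qed.

Theorem corollary4p2 (F : fieldType) (E : fieldExtType F)
    (g h : finLieAlgType E) :
  galois_extension F E ->
  defined_over F g ->
  lie_isomorphic (restrict_scalars E g) (restrict_scalars E h) ->
  defined_over F h \/ indecomposable g ->
  lie_isomorphic g h.
Proof.
move=> galE defg iso_gh [defh|indec_g].
- exact: (lie_iso_both_defined galE).
exact: (lie_iso_indecomposable galE).
Qed.
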